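(* Let $J\in\mathbb{R}^{2N\times 2N}$ be skew-symmetric and invertible, let $H(t)\in\mathbb{R}^{2N\times 2N}$ be symmetric and $P$-periodic, and let $U$ be a constant $2N\times k$ matrix of rank $k$ whose columns belong to a $J$-Lagrangian subspace. Put $$E(t)=(JUU^{T}H(t))^{T}+JUU^{T}H(t)+(UU^{T}J)^{T}H(t)(UU^{T}J).$$ Then any solution $(\widetilde{X}(t))_{t\ge 0}$ of the perturbed system $$J\frac{d\widetilde{X}(t)}{dt}=\left[H(t)+E(t)\right]\widetilde{X}(t),\quad t\ge 0,\qquad \widetilde{X}(0)=I+UU^TJ,$$ is of the form $$\widetilde{X}(t)=(I+UU^TJ)X(t),$$ where $(X(t))_{t\ge 0}$ is the fundamental solution of the unperturbed system $$J\frac{dX(t)}{dt}=H(t)X(t),\quad t\ge 0,\qquad X(0)=I_{2N}.$$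
   Context: $P>0$ and $H(t+P)=H(t)=H(t)^T$. The unperturbed initial value problem is assumed to have a unique solution, called its fundamental solution. $U^T$ denotes the (non-conjugate) transpose. A subspace $\mathcal{L}\subseteq\mathbb{C}^{2N}$ is $J$-Lagrangian if $\dim\mathcal{L}=N$ and $\langle Jx,y\rangle=0$ for all $x,y\in\mathcal{L}$, where $\langle x,y\rangle=\sum_{j=1}^{2N}x_jy_j$ (bilinear). *)

(* Defs.v *)
From HB Require Import structures.
From mathcomp Require Import all_boot all_order all_algebra.
From mathcomp Require Import all_classical all_reals all_analysis.
From mathcomp Require Import complex.

Set Implicit Arguments.
Unset Strict Implicit.
Unset Printing Implicit Defensive.

Import Order.TTheory GRing.Theory Num.Theory.
Import numFieldNormedType.Exports.

Local Open Scope classical_set_scope.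
Local Open Scope ring_scope.
Local Open Scope complex_scope.

Definition mxC (R : realType) (m n : nat) (A : 'M[R]_(m, n)) : 'M[R[i]]_(m, n) :=
  map_mx (real_complex R) A.

                                                                               
Definition bilin (R : realType) (n : nat) (x y : 'cV[R[i]]_n) : R[i] :=
  \sum_(j < n) x j 0 * y j 0.

Definition lagrangian (R : realType) (N : nat) (J : 'M[R[i]]_(2 * N))
    (L : {vspace 'cV[R[i]]_(2 * N)}) : Prop :=
  \dim L = N /\
  (forall x y, x \in L -> y \in L -> bilin (J *m x) y = 0).

                                                                             
                                                                             
                                                                
                                                                         
Definition has_derivative (R : realType) (m n : nat)
    (X : R -> 'M[R[i]]_(m, n)) (t : R) (D : 'M[R[i]]_(m, n)) : Prop :=
  ((s - t)%:C^-1 *: (X s - X t)) @[s --> within [set s | 0 <= s] t^'] -->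
    (D : 'M[R[i]^o]_(m, n)).

                                                         
Definition ivp_solution (R : realType) (n : nat) (J : 'M[R[i]]_n)
    (H : R -> 'M[R[i]]_n) (X0 : 'M[R[i]]_n) (X : R -> 'M[R[i]]_n) : Prop :=
  X 0 = X0 /\
  (forall t, 0 <= t ->
     exists2 D, has_derivative X t D & J *m D = H t *m X t).

                                                                               
Definition fundamental_solution (R : realType) (n : nat) (J : 'M[R[i]]_n)
    (H : R -> 'M[R[i]]_n) (X : R -> 'M[R[i]]_n) : Prop :=
  ivp_solution J H 1%:M X /\
  (forall Y, ivp_solution J H 1%:M Y -> forall t, 0 <= t -> Y t = X t).

Definition perturbation (R : realType) (n k : nat) (J : 'M[R[i]]_n)
    (U : 'M[R[i]]_(n, k)) (Ht : 'M[R[i]]_n) : 'M[R[i]]_n :=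
  (J *m U *m U^T *m Ht)^T + J *m U *m U^T *m Ht
  + (U *m U^T *m J)^T *m Ht *m (U *m U^T *m J).

(* Main.v *)
(** Let [V = U U^T J] and [M = I + V]. Since the columns of [U] lie in a
    Lagrangian subspace, [U^T J U = 0], so [V^2 = 0] and [M^-1 = I - V].
    Skew-symmetry of [J] makes [M] symplectic, [J M^-1 = M^T J], and the
    perturbation is exactly the one giving [M^T (H + E) = H M^-1].
    Hence [M^-1 Xt] solves the unperturbed problem with initial value [I],
    and uniqueness of the fundamental solution concludes. *)
Require Import Defs.
From mathcomp Require Import all_boot all_order all_algebra.
From mathcomp Require Import all_classical all_reals all_analysis.
From mathcomp Require Import complex.
Import Order.TTheory GRing.Theory Num.Theory.
Import numFieldNormedType.Exports.
Local Open Scope ring_scope.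
Local Open Scope complex_scope.

(** Matrix neighbourhoods are generated by boxes of entry neighbourhoods; a filter can intersect the
    box conditions because the index sets are finite. *)
Lemma cvg_mxP (T : topologicalType) (m n : nat) (I : Type)
    (F : set_system I) (FF : Filter F) (f : I -> 'M[T]_(m, n)) (A : 'M[T]_(m, n)) :
  (f x @[x --> F] --> A)%classic <-> (forall i j, (f x i j @[x --> F] --> A i j)%classic).
Proof.
split=> [fA i j B AB | fA B [P AP PB]].
  apply: (fA [set M | B (M i j)]%classic).
  (* A box equal to [B] at position [(i, j)] and to the whole space elsewhere. *)
  exists (fun i' j' => [set x | i' = i -> j' = j -> B x]%classic)
    => [i' j'|M /(_ i j)]; last exact.
  have [-> | ni] := eqVneq i' i; last first.
    by apply: filterE => x /eqP; rewrite (negbTE ni).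
  have [-> | nj] := eqVneq j' j; last first.
    by apply: filterE => x _ /eqP; rewrite (negbTE nj).
  by apply: filterS AB => x Bx _ _.
apply: (@filterS _ F _ [set x | forall i j, P i j (f x i j)]%classic) => [x|].
  exact: PB.
apply: filter_forall => i; apply: filter_forall => j.
exact: fA (AP i j).
Qed.

Lemma cvg_mulmxr (K : numFieldType) (m n p : nat) (I : Type)
    (F : set_system I) (FF : Filter F) (A : 'M[K^o]_(p, m))
    (f : I -> 'M[K^o]_(m, n)) (B : 'M[K^o]_(m, n)) :
  (f x @[x --> F] --> B ->
   A *m f x @[x --> F] --> (A *m B : 'M[K^o]_(p, n)))%classic.
Proof.
move=> /cvg_mxP fB; apply/cvg_mxP => i j; rewrite mxE.
under eq_fun do rewrite mxE.
apply: (@cvg_big K^o) => [|k _]; first exact: add_continuous.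
by apply: cvgM; [exact: cvg_cst | exact: fB].
Qed.

(** A constant left factor passes through the difference quotient by linearity, and through the
    limit by continuity. *)
Lemma has_derivative_mulmx (R : realType) (m n p : nat)
    (A : 'M[R[i]]_(p, m)) (X : R -> 'M[R[i]]_(m, n)) (t : R) (D : 'M[R[i]]_(m, n)) :
  has_derivative X t D -> has_derivative (fun s => A *m X s) t (A *m D).
Proof.
rewrite /has_derivative => XD.
under eq_fun do rewrite -mulmxBr scalemxAr.
exact: cvg_mulmxr XD.
Qed.

Lemma bilinE (R : realType) (n : nat) (x y : 'cV[R[i]]_n) :
  bilin x y = (x^T *m y) 0 0.
Proof. by rewrite mxE; apply: eq_bigr => j _; rewrite mxE. Qed.

(** Each entry of the product is [bilin (J *m x) y] for two columns [x], [y] of [U]; moving [J] off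
    [x] produces the [J^T]. *)
Lemma lagrangian_isotropic (R : realType) (N k : nat) (J : 'M[R[i]]_(2 * N))
    (L : {vspace 'cV[R[i]]_(2 * N)}) (U : 'M[R[i]]_(2 * N, k)) :
  lagrangian J L -> (forall j, col j U \in L) -> U^T *m J^T *m U = 0.
Proof.
case=> _ isoL UL; apply/matrixP => i j; rewrite [RHS]mxE.
rewrite -(isoL _ _ (UL i) (UL j)) bilinE !colE !trmx_mul trmx_delta.
by rewrite -!mulmxA -rowE !mulmxA -colE !mxE.
Qed.

Section Symplectic.
Variables (R : realType) (n k : nat) (J : 'M[R[i]]_n) (U : 'M[R[i]]_(n, k)).
Hypotheses (J_skew : J^T = - J) (U_iso : U^T *m J *m U = 0).

Local Notation V := (U *m U^T *m J).

Lemma isotropic_nilpotent : V *m V = 0.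
Proof.
by rewrite -!mulmxA (mulmxA J U) (mulmxA U^T) (mulmxA U^T J) U_iso mul0mx mulmx0.
Qed.

Lemma isotropic_mulVmx : (1%:M - V) *m (1%:M + V) = 1%:M.
Proof. by rewrite mulmxBl mul1mx mulmxDr mulmx1 isotropic_nilpotent addr0 addrK. Qed.

Lemma isotropic_mulmxV : (1%:M + V) *m (1%:M - V) = 1%:M.
Proof. by rewrite mulmxDl mul1mx mulmxBr mulmx1 isotropic_nilpotent subr0 subrK. Qed.

Lemma isotropic_trmx : V^T = - (J *m U *m U^T).
Proof. by rewrite !trmx_mul trmxK J_skew mulNmx mulmxA. Qed.

(** Both sides expand to [J - J *m U *m U^T *m J]. *)
Lemma isotropic_symplectic : J *m (1%:M - V) = (1%:M + V)^T *m J.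
Proof.
rewrite [(1%:M + V)^T]linearD /= trmx1 isotropic_trmx mulmxBr mulmx1 mulmxDl mul1mx mulNmx.
by rewrite !mulmxA.
Qed.

Lemma perturbationE (Ht : 'M[R[i]]_n) : Ht^T = Ht ->
  Ht + perturbation J U Ht = (1%:M - V)^T *m Ht *m (1%:M - V).
Proof.
(* In terms of [V] alone, [perturbation] consists of the terms other than [Ht] in the expanded
   congruence. *)
move=> H_sym; have -> : perturbation J U Ht = - (Ht *m V) - V^T *m Ht + V^T *m Ht *m V.
  have JUU : J *m U *m U^T = - V^T by rewrite isotropic_trmx opprK.
  by rewrite /perturbation JUU mulNmx [(- (_ *m _))^T]linearN /= trmx_mul trmxK H_sym.
rewrite [(1%:M - V)^T]linearB /= trmx1 mulmxBl mul1mx mulmxBr mulmx1 mulmxBl opprB.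
by rewrite !addrA [RHS]addrAC; congr (_ + _); rewrite addrAC.
Qed.

Lemma perturbation_mulmx (Ht : 'M[R[i]]_n) : Ht^T = Ht ->
  (1%:M + V)^T *m (Ht + perturbation J U Ht) = Ht *m (1%:M - V).
Proof.
move=> H_sym; rewrite perturbationE // !mulmxA -trmx_mul isotropic_mulVmx.
by rewrite trmx1 mul1mx.
Qed.

End Symplectic.

Theorem corollary4p2 (R : realType) (N k : nat)
    (J : 'M[R]_(2 * N)) (P : R) (H : R -> 'M[R]_(2 * N))
    (U : 'M[R[i]]_(2 * N, k)) (L : {vspace 'cV[R[i]]_(2 * N)})
    (X : R -> 'M[R[i]]_(2 * N))
    (J_skew : J^T = - J) (J_inv : J \in unitmx)
    (P_gt0 : 0 < P)
    (H_per : forall t, H (t + P) = H t)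
    (H_sym : forall t, (H t)^T = H t)
    (U_rank : \rank U = k)
    (L_lagr : lagrangian (mxC J) L)
    (U_L : forall j : 'I_k, col j U \in L)
    (X_fund : fundamental_solution (mxC J) (fun t => mxC (H t)) X) :
  forall Xt : R -> 'M[R[i]]_(2 * N),
    ivp_solution (mxC J)
      (fun t => mxC (H t) + perturbation (mxC J) U (mxC (H t)))
      (1%:M + U *m U^T *m mxC J) Xt ->
    forall t : R, 0 <= t -> Xt t = (1%:M + U *m U^T *m mxC J) *m X t.
Proof.
have JC_skew : (mxC J)^T = - mxC J by rewrite /mxC map_trmx J_skew map_mxN.
have HC_sym t : (mxC (H t))^T = mxC (H t) by rewrite /mxC map_trmx H_sym.
have U_iso : U^T *m mxC J *m U = 0.
  (* A sign change turns [J] into [J^T], the form supplied by isotropy. *)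
  apply/eqP; rewrite -oppr_eq0 -mulNmx -mulmxN -JC_skew.
  by rewrite (lagrangian_isotropic _ _ _ _ _ _ L_lagr U_L).
case: X_fund => _ X_uniq Xt [Xt0 XtD] t t_ge0.
rewrite -(X_uniq (fun s => (1%:M - U *m U^T *m mxC J) *m Xt s)) //.
  by rewrite mulmxA isotropic_mulmxV // mul1mx.
split=> [|s s_ge0]; first by rewrite Xt0 isotropic_mulVmx.
have [D XtsD JD] := XtD s s_ge0.
exists ((1%:M - U *m U^T *m mxC J) *m D); first exact: has_derivative_mulmx.
(* With [M = I + V] and [E] the perturbation: [J M^-1 D = M^T J D = M^T (H + E) Xt = H M^-1 Xt]. *)
by rewrite mulmxA isotropic_symplectic // -mulmxA JD mulmxA perturbation_mulmx // mulmxA.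
Qed.
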